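(* Let $A\in\mathbb{C}_{n,n}$ have core-EP decomposition $A=A_1+A_2$ with $$A_1=U\begin{bmatrix}T&S\\0&0\end{bmatrix}U^\ast,\qquad A_2=U\begin{bmatrix}0&0\\0&N\end{bmatrix}U^\ast,$$ where $U$ is unitary, $T$ is non-singular and $N$ is nilpotent. Then the WG inverse $A^{(W)}$ of $A$ satisfies $$A^{(W)}=A_1^{\#}=U\begin{bmatrix}T^{-1}&T^{-2}S\\0&0\end{bmatrix}U^\ast .$$
   Context: $\mathbb{C}_{m,n}$ is the set of complex $m\times n$ matrices and $A^\ast$ the conjugate transpose. The index $\mathrm{Ind}(A)$ is the smallest positive integer $k$ with $\mathrm{rk}(A^{k+1})=\mathrm{rk}(A^k)$. For a matrix $M$ of index one, the group inverse $M^\#$ is the unique $X$ with $XM^2=M$, $XMX=X$, $MX=XM$. Core-EP decomposition (known): every $A\in\mathbb{C}_{n,n}$ with $\mathrm{Ind}(A)=k$ can be written uniquely as $A=A_1+A_2$ with $\mathrm{Ind}(A_1)=1$, $A_2^k=0$ and $A_1^\ast A_2=A_2A_1=0$ (one or both of $A_1,A_2$ may be null), and there is a unitary $U$ putting $A_1,A_2$ in the displayed block form (blocks may be empty). The core-EP inverse of $A$ is $A^{(\dag)}=U\begin{bmatrix}T^{-1}&0\\0&0\end{bmatrix}U^\ast$ (independent of the choice of $U$). The WG (weak group) inverse $A^{(W)}$ of $A$ is the unique $X\in\mathbb{C}_{n,n}$ satisfying $AX^2=X$ and $AX=A^{(\dag)}A$. *)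

(* Defs.v *)
From mathcomp Require Import all_boot all_order all_algebra.
From mathcomp Require Import spectral.

Set Implicit Arguments.
Unset Strict Implicit.
Unset Printing Implicit Defensive.

Import GRing.Theory.
Local Open Scope ring_scope.
Local Open Scope sesquilinear_scope.

Lemma mxindex_exists (F : fieldType) (n : nat) (A : 'M[F]_n) :
  exists k, (0 < k)%N && (\rank (A ^+ k.+1) == \rank (A ^+ k)).
Proof.
have drop k : (\rank (A ^+ k.+1) <= \rank (A ^+ k))%N.
  by rewrite exprS; apply: mxrankM_maxr.
suff: forall m k, (0 < k)%N -> (\rank (A ^+ k) <= m)%N ->
    exists j, (0 < j)%N && (\rank (A ^+ j.+1) == \rank (A ^+ j)).
  by move=> /(_ _ 1%N isT (leqnn _)).
elim=> [|m IHm] k k_gt0 le_k.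
  exists k; rewrite k_gt0 eqn_leq drop.
  by move: le_k; rewrite leqn0 => /eqP->.
have [eq_k|ne_k] := eqVneq (\rank (A ^+ k.+1)) (\rank (A ^+ k)).
  by exists k; rewrite k_gt0 eq_k eqxx.
apply: (IHm k.+1) => //; rewrite -ltnS (leq_trans _ le_k) //.
by rewrite ltn_neqAle ne_k drop.
Qed.

(* The smallest positive k, so invertible and null matrices have index 1. *)
Definition mxindex (F : fieldType) (n : nat) (A : 'M[F]_n) : nat :=
  ex_minn (mxindex_exists A).

Definition mxnilpotent (F : fieldType) (n : nat) (N : 'M[F]_n) : Prop :=
  exists m : nat, N ^+ m = 0.

(* [unique P X] means: P X holds, and every Y with P Y equals X. *)
Definition is_group_inverse (F : fieldType) (n : nat) (M X : 'M[F]_n) : Prop :=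
  unique (fun X : 'M[F]_n =>
    [/\ X *m (M *m M) = M, X *m M *m X = X & M *m X = X *m M]) X.

Section CoreEP.

Variable C : numClosedFieldType.

Definition core_ep_decomposition (n : nat) (A A1 A2 : 'M[C]_n) : Prop :=
  [/\ A = A1 + A2,
      mxindex A1 = 1%N,
      A2 ^+ mxindex A = 0,
      A1^t* *m A2 = 0
    & A2 *m A1 = 0].

(* U [Mul Mur; Mdl Mdr] U^*; either block may be empty (r = 0 or s = 0). *)
Definition block_conj (n r s : nat) (e : (r + s)%N = n) (U : 'M[C]_n)
    (Mul : 'M[C]_r) (Mur : 'M[C]_(r, s)) (Mdl : 'M[C]_(s, r)) (Mdr : 'M[C]_s) :
    'M[C]_n :=
  U *m castmx (e, e) (block_mx Mul Mur Mdl Mdr) *m U^t*.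

Definition core_ep_block_form (n r s : nat) (e : (r + s)%N = n)
    (A1 A2 U : 'M[C]_n) (T : 'M[C]_r) (S : 'M[C]_(r, s)) (N : 'M[C]_s) : Prop :=
  [/\ U \is unitarymx, T \in unitmx, mxnilpotent N,
      A1 = block_conj e U T S 0 0
    & A2 = block_conj e U 0 0 0 N].

(* [unique] expresses that the result does not depend on the block form
   chosen. *)
Definition is_core_ep_inverse (n : nat) (A E : 'M[C]_n) : Prop :=
  unique (fun E : 'M[C]_n =>
    exists (r s : nat) (e : (r + s)%N = n) (A1 A2 U : 'M[C]_n)
           (T : 'M[C]_r) (S : 'M[C]_(r, s)) (N : 'M[C]_s),
      [/\ core_ep_decomposition A A1 A2,
          core_ep_block_form e A1 A2 U T S N
        & E = block_conj e U (invmx T) 0 0 0]) E.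

Definition is_wg_inverse (n : nat) (A X : 'M[C]_n) : Prop :=
  exists2 E : 'M[C]_n, is_core_ep_inverse A E &
    unique (fun X : 'M[C]_n => A *m (X *m X) = X /\ A *m X = E *m A) X.

End CoreEP.

(* Main.v *)
Require Import Defs.
From mathcomp Require Import all_boot all_order all_algebra.
From mathcomp Require Import reals.
From mathcomp Require Import complex.
From mathcomp Require Import spectral.

Set Implicit Arguments.
Unset Strict Implicit.
Unset Printing Implicit Defensive.

Import GRing.Theory.
Local Open Scope ring_scope.
Local Open Scope sesquilinear_scope.

(** The core-EP inverse [E] of [A] read off a block form satisfies the three
    equations [E A^(m+1) = A^m] (for [m] large, as [N] is nilpotent),
    [A E^2 = E] and [(A E)^* = A E].  These determine [E], whatever block form
    it came from ([core_ep_equations_uniq]): for two solutions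
    [X], [Y] one gets [Y A X = X] and [X A Y = Y], so the Hermitian idempotents
    [A X] and [A Y] absorb each other and hence coincide.

    The second equation alone then settles the weak group inverse: if
    [A X^2 = X] and [A X = E A], then [X = (A X) X = E (A X) = E^2 A], and
    [E^2 A] is a solution ([wg_equations_uniq]).

    Finally [E A_2 = 0], so the weak group inverse is [E^2 A_1]; since
    [E A_1^2 = A_1] and [A_1 E^2 = E], this product satisfies the equations of
    the group inverse of [A_1], and multiplying out the blocks gives its
    displayed form. *)

Section BlockConj.

Variables (C : numClosedFieldType) (n r s : nat) (e : (r + s)%N = n).
Variable U : 'M[C]_n.

Lemma mul_block_conj Mul Mur Mdl Mdr Kul Kur Kdl Kdr : U \is unitarymx ->
  block_conj e U Mul Mur Mdl Mdr *m block_conj e U Kul Kur Kdl Kdr =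
  block_conj e U (Mul *m Kul + Mur *m Kdl) (Mul *m Kur + Mur *m Kdr)
                 (Mdl *m Kul + Mdr *m Kdl) (Mdl *m Kur + Mdr *m Kdr).
Proof.
move/unitarymxP/mulmx1C; rewrite /block_conj.
case: n / e U => V VV; rewrite !castmx_id -mulmx_block.
by rewrite !mulmxA -[_ *m V^t* *m V]mulmxA VV mulmx1.
Qed.

Lemma block_conj0 : block_conj e U 0 0 0 0 = 0.
Proof.
rewrite /block_conj; case: n / e U => V.
by rewrite castmx_id block_mx0 mulmx0 mul0mx.
Qed.

Lemma adj_block_conj Mul Mur Mdl Mdr :
  (block_conj e U Mul Mur Mdl Mdr)^t* =
  block_conj e U (Mul^t*) (Mdl^t*) (Mur^t*) (Mdr^t*).
Proof.
rewrite /block_conj; case: n / e U => V; rewrite !castmx_id.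
by rewrite !trmx_mul !map_mxM /= trmxCK tr_block_mx map_block_mx mulmxA.
Qed.

(** The exponent grows by one because [N ^+ 0 = 0] holds for an empty block
    [N], while the zeroth power of the whole matrix is the identity. *)
Lemma block_conj_nilpotent N m : U \is unitarymx -> N ^+ m = 0 ->
  block_conj e U 0 0 0 N ^+ m.+1 = 0.
Proof.
move=> Uunit Nm0.
suff -> k : block_conj e U 0 0 0 N ^+ k.+1 = block_conj e U 0 0 0 (N ^+ k.+1).
  by rewrite exprS Nm0 mulr0 block_conj0.
elim: k => [|k IHk]; first by rewrite !expr1.
rewrite exprS IHk -[LHS]/(_ *m _) mul_block_conj //.
by rewrite !(mulmx0, mul0mx, addr0, add0r) [in RHS]exprS.
Qed.

End BlockConj.

Section Equations.

Variables (C : numClosedFieldType) (n : nat).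
Implicit Types A E M X Y : 'M[C]_n.

(** The equational characterization of the core-EP inverse: unlike the block
    form, it does not mention a unitary matrix. *)
Definition core_ep_equations (m : nat) A E :=
  [/\ E *m A ^+ m.+1 = A ^+ m, A *m (E *m E) = E & (A *m E)^t* = A *m E].

Lemma core_ep_equations_widen m k A E :
  core_ep_equations m A E -> core_ep_equations (m + k) A E.
Proof.
by case=> EA AE2 AEadj; split=> //; rewrite -addSn !exprD -!mulmxE mulmxA EA.
Qed.

(** Iterating [A X^2 = X] puts the range of any solution inside that of every
    power of [A], where all solutions act as left inverses of [A]. *)
Lemma core_ep_equations_absorb m A X Y :
  core_ep_equations m A X -> core_ep_equations m A Y -> Y *m A *m X = X.
Proof.
case=> _ AX2 _ [YA _ _].
have powX k : A ^+ k *m X ^+ k.+1 = X.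
  elim: k => [|k IHk]; first by rewrite expr0 expr1 mul1mx.
  rewrite exprSr (exprS X k.+1) (exprS X k) -!mulmxE -!mulmxA (mulmxA X X).
  by rewrite (mulmxA A) AX2 mulmxE -exprS.
by rewrite -{1}(powX m) -mulmxA (mulmxA A) -[A *m _]exprS mulmxA YA powX.
Qed.

(** The idempotents [A X] and [A Y] have the same range, and Hermitian
    idempotents are determined by their range. *)
Lemma core_ep_equations_uniq m k A X Y :
  core_ep_equations m A X -> core_ep_equations k A Y -> X = Y.
Proof.
move=> /(core_ep_equations_widen k) eqX /(core_ep_equations_widen m) eqY.
rewrite addnC in eqY.
have YAX := core_ep_equations_absorb eqX eqY.
have XAY := core_ep_equations_absorb eqY eqX.
have YAY := core_ep_equations_absorb eqY eqY.
case: eqX eqY => _ _ adjAX [_ _ adjAY].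
(* [A X A Y] is the adjoint of [A Y A X], which is [A X]. *)
have AXAY : A *m X *m (A *m Y) = A *m X.
  rewrite -{1}adjAX -{1}adjAY -map_mxM -trmx_mul.
  by rewrite mulmxA -(mulmxA A Y A) -mulmxA YAX.
have AXY : A *m Y = A *m X by rewrite -AXAY mulmxA -(mulmxA A X A) -mulmxA XAY.
by rewrite -YAX -mulmxA -AXY mulmxA YAY.
Qed.

Lemma wg_equations_uniq A E : A *m (E *m E) = E ->
  unique (fun X : 'M[C]_n => A *m (X *m X) = X /\ A *m X = E *m A)
    (E *m E *m A).
Proof.
move=> AE2.
have AX : A *m (E *m E *m A) = E *m A by rewrite mulmxA AE2.
split=> [|X [AX2 AXE]].
  by split=> //; rewrite mulmxA AX -[E *m A *m _]mulmxA AX mulmxA.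
by rewrite -mulmxA -AXE mulmxA -AXE -mulmxA AX2.
Qed.

Lemma group_inverse_equations_uniq M X :
    [/\ X *m (M *m M) = M, X *m M *m X = X & M *m X = X *m M] ->
  is_group_inverse M X.
Proof.
move=> eqX; split=> // Y eqY.
case: eqX eqY => XM2 XMX MX [YM2 YMY MY].
have M2Y : M *m M *m Y = M by rewrite -mulmxA MY mulmxA MY -mulmxA.
have XM : X *m M = M *m Y by rewrite -{1}M2Y mulmxA XM2.
by rewrite -XMX XM MY -mulmxA MX XM mulmxA YMY.
Qed.

(** The hypotheses say that [E] inverts [M] on the range of [M] and has its
    own range there; then [M] commutes with [E^2 M] because both products reduce
    to [E M]. *)
Lemma group_inverse_square_mul M E :
  E *m M *m M = M -> M *m (E *m E) = E -> is_group_inverse M (E *m E *m M).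
Proof.
move=> EM2 ME2; apply: group_inverse_equations_uniq.
have XM : E *m E *m M *m M = E *m M by rewrite -!mulmxA (mulmxA E M) EM2.
split; last by rewrite XM mulmxA ME2.
  by rewrite mulmxA XM.
by rewrite XM -!mulmxA (mulmxA M) (mulmxA (M *m E)) -(mulmxA M) ME2.
Qed.

End Equations.

Section BlockForm.

Variables (C : numClosedFieldType) (n r s : nat) (e : (r + s)%N = n).
Variables (A1 A2 U : 'M[C]_n) (T : 'M[C]_r) (S : 'M[C]_(r, s)) (N : 'M[C]_s).
Hypothesis blk : core_ep_block_form e A1 A2 U T S N.

Let E := block_conj e U (invmx T) 0 0 0.
Let bE := (mulmx0, mul0mx, mulmx1, mul1mx, addr0, add0r).

Lemma core_ep_block_mulE2 : A1 *m (E *m E) = E.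
Proof.
case: blk => Uu Tu _ -> _; rewrite /E !mul_block_conj // !bE.
by rewrite mulKVmx.
Qed.

Lemma core_ep_block_Emul2 : E *m A1 *m A1 = A1.
Proof.
case: blk => Uu Tu _ -> _; rewrite /E !mul_block_conj // !bE.
by rewrite mulVmx // !mul1mx.
Qed.

Lemma core_ep_block_Emul_nil : E *m A2 = 0.
Proof.
by case: blk => Uu _ _ _ ->; rewrite /E mul_block_conj // !bE block_conj0.
Qed.

Lemma core_ep_block_nil_mulE : A2 *m E = 0.
Proof.
by case: blk => Uu _ _ _ ->; rewrite /E mul_block_conj // !bE block_conj0.
Qed.

Lemma core_ep_block_nil_mul : A2 *m A1 = 0.
Proof.
by case: blk => Uu _ _ -> ->; rewrite mul_block_conj // !bE block_conj0.
Qed.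

(** Large powers of [A1 + A2] have their range in that of [A1], where [E]
    inverts [A1] and hence [A1 + A2], as [A2 A1 = 0]; [(A1 + A2) E] is Hermitian
    because it is the orthogonal projector [U diag(1, 0) U^*]. *)
Lemma core_ep_block_equations :
  exists m, core_ep_equations m (A1 + A2) E.
Proof.
have [Uu Tu [m Nm0] defA1 defA2] := blk.
have A2m : A2 ^+ m.+1 = 0 by rewrite defA2 (block_conj_nilpotent _ _ Nm0).
(* As [A2 A1 = 0], in a power of [A1 + A2] only the term [A2 ^+ k] does not
   start with [A1]. *)
have defAm k : exists Q, (A1 + A2) ^+ k.+1 = A1 *m Q + A2 ^+ k.+1.
  elim: k => [|k [Q IHk]]; first by exists 1%:M; rewrite !expr1 mulmx1.
  exists (A1 *m Q + A2 ^+ k.+1).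
  rewrite exprS IHk -mulmxE mulmxDl mulmxDr; congr (_ + _).
  rewrite mulmxDr mulmxA core_ep_block_nil_mul mul0mx add0r.
  by rewrite [RHS]exprS.
exists m.+1; split.
- have [Q defQ] := defAm m; rewrite exprS defQ A2m addr0 -mulmxE !mulmxA.
  by rewrite mulmxDr core_ep_block_Emul_nil addr0 core_ep_block_Emul2.
- rewrite mulmxDl core_ep_block_mulE2 mulmxA core_ep_block_nil_mulE.
  by rewrite mul0mx addr0.
rewrite mulmxDl core_ep_block_nil_mulE addr0 defA1 /E mul_block_conj // !bE.
by rewrite mulmxV // adj_block_conj !trmx0 !map_mx0 trmx1 map_mx1.
Qed.

Lemma core_ep_block_wg_inverse :
  E *m E *m (A1 + A2) = block_conj e U (invmx T) (invmx T *m invmx T *m S) 0 0.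
Proof.
rewrite mulmxDr -[_ *m A2]mulmxA core_ep_block_Emul_nil mulmx0 addr0.
case: blk => Uu Tu _ -> _; rewrite /E !mul_block_conj // !bE.
by rewrite mulmxKV.
Qed.

End BlockForm.

(** Two block forms, possibly of different shapes, give solutions of the same
    equations. *)
Lemma core_ep_block_is_inverse (C : numClosedFieldType) (n r s : nat)
    (e : (r + s)%N = n) (A A1 A2 U : 'M[C]_n)
    (T : 'M[C]_r) (S : 'M[C]_(r, s)) (N : 'M[C]_s) :
    core_ep_decomposition A A1 A2 -> core_ep_block_form e A1 A2 U T S N ->
  is_core_ep_inverse A (block_conj e U (invmx T) 0 0 0).
Proof.
move=> dec blk; split; first by exists r, s, e, A1, A2, U, T, S, N.
move=> _ [r' [s' [e' [B1 [B2 [V [T' [S' [N' [dec' blk' ->]]]]]]]]]].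
have [m] := core_ep_block_equations blk.
have [k] := core_ep_block_equations blk'.
case: dec dec' => <- _ _ _ _ [<- _ _ _ _] eqE' eqE.
exact: core_ep_equations_uniq eqE eqE'.
Qed.

Theorem theorem3p2 (R : realType) (n r s : nat) (e : (r + s)%N = n)
    (A A1 A2 U : 'M[R[i]]_n)
    (T : 'M[R[i]]_r) (S : 'M[R[i]]_(r, s)) (N : 'M[R[i]]_s)
    (hdec : core_ep_decomposition A A1 A2)
    (hblk : core_ep_block_form e A1 A2 U T S N) :
  exists W : 'M[R[i]]_n,
    [/\ is_wg_inverse A W,
        is_group_inverse A1 W
      & W = block_conj e U (invmx T) (invmx T *m invmx T *m S) 0 0].
Proof.
have defA : A = A1 + A2 by case: hdec.
pose E := block_conj e U (invmx T) 0 0 0.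
exists (E *m E *m A); split.
- exists E; first exact: core_ep_block_is_inverse hdec hblk.
  apply: wg_equations_uniq; rewrite defA.
  by have [m []] := core_ep_block_equations hblk.
- rewrite defA mulmxDr -[_ *m A2]mulmxA (core_ep_block_Emul_nil hblk).
  rewrite mulmx0 addr0; apply: group_inverse_square_mul.
    exact: core_ep_block_Emul2 hblk.
  exact: core_ep_block_mulE2 hblk.
by rewrite defA; exact: core_ep_block_wg_inverse hblk.
Qed.
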